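(* For every fuzzy graph $G=(V,\sigma,\mu)$, $$\gamma_s(G)\le \gamma_{snR}(G)\le 2\gamma_s(G).$$
   Context: A fuzzy graph $G=(V,\sigma,\mu)$ consists of a finite nonempty set $V$, a function $\sigma:V\to[0,1]$, and a symmetric function $\mu:V\times V\to[0,1]$ with $\mu(x,x)=0$ and $\mu(x,y)\le \min\{\sigma(x),\sigma(y)\}$ for all $x,y\in V$. An edge is an unordered pair $(u,v)$ of distinct vertices with $\mu(u,v)>0$, and $\mu(u,v)$ is its weight. The strength of a path $x_0,x_1,\ldots,x_m$ (with every $\mu(x_{i-1},x_i)>0$) is $\min_i \mu(x_{i-1},x_i)$, and $CONN_G(u,v)$ is the maximum strength of all $u$–$v$ paths. An edge $(u,v)$ is strong if $\mu(u,v)=CONN_G(u,v)$; then $u,v$ are strong neighbors. $N_s(u)$ is the set of strong neighbors of $u$. Put $\mu_s(u)=\min\{\mu(u,v):v\in N_s(u)\}$, with $\mu_s(u)=0$ if $N_s(u)=\emptyset$. A strong dominating set is a set $D\subseteq V$ such that every vertex of $V\setminus D$ is a strong neighbor of some vertex of $D$; its weight is $W(D)=\sum_{u\in D}\mu_s(u)$, and $\gamma_s(G)$ is the minimum weight of a strong dominating set of $G$. A strong-neighbors Roman dominating function (SNRDF) on $G$ is a function $f:V\to\{0,1,2\}$ such that every $u$ with $f(u)=0$ has some $v\in N_s(u)$ with $f(v)=2$. Its weight is $w(f)=\sum_{u\in V}f(u)\mu_s(u)$, and $\gamma_{snR}(G)$ is the minimum weight of an SNRDF on $G$. *)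

(* Defs.v *)
From HB Require Import structures.
From mathcomp Require Import all_boot all_order all_algebra.
From mathcomp Require Import reals.

Set Implicit Arguments.
Unset Strict Implicit.
Unset Printing Implicit Defensive.

Import Order.TTheory GRing.Theory Num.Theory.
Local Open Scope ring_scope.

Record fuzzyGraph (R : realType) (V : finType) := FuzzyGraph {
  sigma : V -> R;
  mu : V -> V -> R;
  card_vertex_gt0 : (0 < #|V|)%N;
  sigma_itv : forall x, 0 <= sigma x <= 1;
  mu_itv : forall x y, 0 <= mu x y <= 1;
  mu_sym : forall x y, mu x y = mu y x;
  mu_irr : forall x, mu x x = 0;
  mu_le_sigma : forall x y, mu x y <= Num.min (sigma x) (sigma y)
}.

Section FuzzyGraphTheory.
Variables (R : realType) (V : finType) (G : fuzzyGraph R V).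

Definition is_edge : rel V := fun u v => (u != v) && (0 < mu G u v).

(* A path is given by its first vertex u and the list p of the next ones;
   its vertices are pairwise distinct. *)
Definition is_path (u v : V) (p : seq V) : bool :=
  [&& path is_edge u p, last u p == v & uniq (u :: p)].

(* Minimum of the weights of the edges of x :: p. All weights are at most 1, so
   the default value 1 only matters when p is empty. *)
Definition strength (x : V) (p : seq V) : R :=
  \big[Num.min/1]_(w <- pairmap (mu G) x p) w.

(* A path has at most #|V| vertices, hence fewer than #|V| edges. All strengths
   are positive, so the default value 0 only matters when there is no path. *)
Definition CONN (u v : V) : R :=
  \big[Num.max/0]_(m < #|V|)
    \big[Num.max/0]_(p : m.-tuple V | is_path u v p) strength u p.

Definition strong_edge : rel V :=
  fun u v => is_edge u v && (mu G u v == CONN u v).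

Definition strong_nbrs (u : V) : {set V} := [set v | strong_edge u v].

(* All weights are at most 1, so the default value 1 is neutral. *)
Definition mu_s (u : V) : R :=
  if strong_nbrs u == set0 then 0
  else \big[Num.min/1]_(v in strong_nbrs u) mu G u v.

Definition strong_dominating (D : {set V}) : bool :=
  [forall v, (v \notin D) ==> [exists u in D, v \in strong_nbrs u]].

Definition set_weight (D : {set V}) : R := \sum_(u in D) mu_s u.

(* The default value is the weight of [set: V], which is strong dominating. *)
Definition gamma_s : R :=
  \big[Num.min/set_weight [set: V]]_(D : {set V} | strong_dominating D)
    set_weight D.

Definition SNRDF (f : {ffun V -> 'I_3}) : bool :=
  [forall u, (f u == 0%N :> nat) ==>
     [exists v in strong_nbrs u, f v == 2%N :> nat]].

Definition fun_weight (f : {ffun V -> 'I_3}) : R :=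
  \sum_(u : V) (f u)%:R * mu_s u.

(* The default value is the weight of the constant function 2, an SNRDF. *)
Definition gamma_snR : R :=
  \big[Num.min/fun_weight [ffun => ord_max]]_(f : {ffun V -> 'I_3} | SNRDF f)
    fun_weight f.

End FuzzyGraphTheory.

(* Main.v *)
Require Import Defs.
From mathcomp Require Import all_boot all_order all_algebra.
From mathcomp Require Import reals.

Import Order.TTheory GRing.Theory Num.Theory.
Local Open Scope ring_scope.

(** If [f] is an SNRDF, then the support of [f] is strong dominating and weighs
    at most as much as [f]; if [D] is strong dominating, then twice its indicator
    function is an SNRDF. Domination looks at strong neighbors of vertices of [D]
    and an SNRDF at those of vertices where [f] vanishes, so both rely on the
    symmetry of the strong neighbor relation, which follows by reversing paths. *)

(** With a path stored as its first vertex [x] and the list [p] of the next ones, the reversed path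
    has first vertex [last x p] and next vertices [rev (belast x p)]. *)
Lemma last_rev_belast (T : Type) (x : T) (p : seq T) :
  last (last x p) (rev (belast x p)) = x.
Proof.
by case: p => //= y p; rewrite rev_cons last_rcons.
Qed.

Lemma pairmap_rev_belast (S T : Type) (f : T -> T -> S) (x : T) (p : seq T) :
  (forall a b, f a b = f b a) ->
  pairmap f (last x p) (rev (belast x p)) = rev (pairmap f x p).
Proof.
move=> fC; elim: p x => //= y p IHp x.
by rewrite !rev_cons -!cats1 pairmap_cat /= IHp last_rev_belast fC.
Qed.

Section StrongNeighbors.
Variables (R : realType) (V : finType) (G : fuzzyGraph R V).

Lemma is_edgeC (u v : V) : is_edge G u v = is_edge G v u.
Proof. by rewrite /is_edge eq_sym mu_sym. Qed.

Lemma is_path_rev (u v : V) (p : seq V) :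
  is_path G u v p -> is_path G v u (rev (belast u p)).
Proof.
case/and3P=> up /eqP <- Up; apply/and3P; split.
- by rewrite rev_path (eq_path (e' := is_edge G)) // => a b; apply: is_edgeC.
- by rewrite last_rev_belast.
(* The vertex list of the reversed path is exactly [rev (u :: p)]. *)
- by rewrite -rev_rcons -lastI rev_uniq.
Qed.

Lemma strength_rev (u : V) (p : seq V) :
  strength G (last u p) (rev (belast u p)) = strength G u p.
Proof.
rewrite /strength pairmap_rev_belast; last exact: mu_sym.
by apply: perm_big; rewrite perm_rev.
Qed.

(** Reversal turns each path from [u] to [v] into a path from [v] to [u] with the same length and
    strength. *)
Lemma CONN_le_sym (u v : V) : CONN G u v <= CONN G v u.
Proof.
(* Both nested maxima have default value 0, which must be bounded too. *)
have CONN_ge0 : 0 <= CONN G v u by apply: bigmax_ge_id.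
apply/bigmax_leP; split=> // m _; apply/bigmax_leP; split=> // p up.
have sz : size (rev (belast u p)) == m by rewrite size_rev size_belast size_tuple.
have /and3P[_ /eqP lastp _] := up.
apply: (bigmax_sup m) => //; apply: (bigmax_sup (Tuple sz)).
  exact: is_path_rev.
by rewrite /= -lastp strength_rev.
Qed.

Lemma CONNC (u v : V) : CONN G u v = CONN G v u.
Proof. by apply: le_anti; rewrite !CONN_le_sym. Qed.

Lemma strong_nbrsC (u v : V) : (v \in strong_nbrs G u) = (u \in strong_nbrs G v).
Proof. by rewrite !inE /strong_edge is_edgeC mu_sym CONNC. Qed.

Lemma mu_s_ge0 (u : V) : 0 <= mu_s G u.
Proof.
rewrite /mu_s; case: ifP => // _; apply/bigmin_geP; split=> // v _.
by case/andP: (mu_itv G u v).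
Qed.

Lemma gamma_s_le (D : {set V}) : strong_dominating G D -> gamma_s G <= set_weight G D.
Proof. by move=> domD; apply: (bigmin_inf D). Qed.

Lemma gamma_snR_le (f : {ffun V -> 'I_3}) : SNRDF G f -> gamma_snR G <= fun_weight G f.
Proof. by move=> fP; apply: (bigmin_inf f). Qed.

Lemma strong_dominating_support (f : {ffun V -> 'I_3}) :
  SNRDF G f -> strong_dominating G [set u | f u != 0%N :> nat].
Proof.
move=> /forallP fP; apply/forallP=> v; apply/implyP; rewrite inE negbK => fv0.
have /existsP[u /andP[uv fu2]] := implyP (fP v) fv0.
by apply/existsP; exists u; rewrite inE (eqP fu2) strong_nbrsC.
Qed.

(** Termwise comparison: [f u] is at least 1 on the support and [mu_s] is nonnegative. *)
Lemma set_weight_support (f : {ffun V -> 'I_3}) :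
  set_weight G [set u | f u != 0%N :> nat] <= fun_weight G f.
Proof.
rewrite /set_weight big_mkcond; apply: ler_sum => u _; rewrite inE.
case: eqP => [->|/eqP fu_neq0] /=; first by rewrite mul0r.
by rewrite ler_peMl ?mu_s_ge0 // ler1n lt0n.
Qed.

Lemma SNRDF_indicator (D : {set V}) : strong_dominating G D ->
  SNRDF G [ffun u => if u \in D then ord_max else ord0].
Proof.
move=> /forallP domD; apply/forallP=> v; apply/implyP; rewrite ffunE.
case: ifP => //= /negbT vD _.
have /existsP[u /andP[uD vu]] := implyP (domD v) vD.
by apply/existsP; exists u; rewrite ffunE uD strong_nbrsC vu.
Qed.

Lemma fun_weight_indicator (D : {set V}) :
  fun_weight G [ffun u => if u \in D then ord_max else ord0] = 2 * set_weight G D.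
Proof.
rewrite /set_weight mulr_sumr [RHS]big_mkcond; apply: eq_bigr => u _.
by rewrite ffunE; case: ifP; rewrite ?mul0r.
Qed.

Lemma strong_dominatingT : strong_dominating G [set: V].
Proof. by apply/forallP=> v; rewrite inE. Qed.

Lemma SNRDF_const2 : SNRDF G [ffun => ord_max].
Proof. by apply/forallP=> v; rewrite ffunE. Qed.

End StrongNeighbors.

Theorem theorem3p1 (R : realType) (V : finType) (G : fuzzyGraph R V) :
  gamma_s G <= gamma_snR G <= 2 * gamma_s G.
Proof.
apply/andP; split.
  have le_f f : SNRDF G f -> gamma_s G <= fun_weight G f.
    move=> /strong_dominating_support/gamma_s_le/le_trans; apply.
    exact: set_weight_support.
  (* The default value of the minimum is the weight of the constant function 2, so it obeys the same
     bound. *)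
  by apply/bigmin_geP; split=> [|f]; apply: le_f; apply: SNRDF_const2.
(* Halving leaves the minimum [gamma_s] alone on the right, so that it can be bounded below set by
   set. *)
have le_D D : strong_dominating G D -> gamma_snR G / 2 <= set_weight G D.
  move=> /SNRDF_indicator/gamma_snR_le.
  by rewrite fun_weight_indicator ler_pdivrMr ?ltr0n // mulrC.
rewrite mulrC -ler_pdivrMr ?ltr0n //.
by apply/bigmin_geP; split=> [|D]; apply: le_D; apply: strong_dominatingT.
Qed.
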